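(* Let $k_0$ be a field and suppose $M_*$ is a cycle module with ring structure. The algebra of additive operations $\varphi:K^M_i\to M_*$ over $k_0$ is the free $M_*(k_0)$-module generated by the identity (i.e. by the operation $x\mapsto x\cdot1$).
   Context: $K^M_*(k)$ is the Milnor $K$-ring of the field $k$, and $K^M_i(k)$ ($i\ge0$) its degree $i$ part. A cycle module (in the sense of M. Rost, ''Chow groups with coefficients'') is a $\mathbf{Z}$-graded functor $M_*$ from fields to abelian groups with four structural data (restriction maps, norm maps for finite extensions, a graded $K^M_*(k)$-module structure on $M_*(k)$, and residue maps $\partial_v:M_*(k)\to M_{*-1}(\kappa(v))$ for discrete valuations) satisfying Rost's rules and axioms; it has a ring structure if moreover there is a pairing $M\times M\to M$ making each $M_*(k)$ an associative graded-commutative ring with unit $1\in M_0(k)$, compatibly with the data. An operation $\varphi:K^M_i\to M_*$ over $k_0$ is a family of functions $K^M_i(k)\to M_*(k)$, one for each field extension $k/k_0$, compatible with field extensions over $k_0$. It is additive if $\varphi(x+y)=\varphi(x)+\varphi(y)$ for all $k/k_0$ and $x,y\in K^M_i(k)$. Additive operations form a module over $M_*(k_0)$ via $(a\cdot\varphi)(x)=a_k\cdot\varphi(x)$, with $a_k$ the image of $a$ in $M_*(k)$. *)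

(* Defs.v *)
From HB Require Import structures.
From mathcomp Require Import all_boot all_order all_algebra generic_quotient.
From mathcomp Require Import boolp classical_sets cardinality.

Set Implicit Arguments.
Unset Strict Implicit.
Unset Printing Implicit Defensive.

Import Order.TTheory GRing.Theory Num.Theory.
Local Open Scope classical_set_scope.
Local Open Scope ring_scope.
Local Open Scope quotient_scope.

Record fext (k0 : fieldType) := Fext {
  fsort :> fieldType;
  fstr : {rmorphism k0 -> fsort}
}.

Record fhom (k0 : fieldType) (F E : fext k0) := FHom {
  fmap :> {rmorphism F -> E};
  fmap_str : forall a : k0, fmap (fstr F a) = fstr E a
}.

Definition fbase (k0 : fieldType) : fext k0 := @Fext k0 k0 idfun.

Definition fbase_hom (k0 : fieldType) (F : fext k0) : fhom (fbase k0) F :=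
  @FHom k0 (fbase k0) F (fstr F) (fun=> erefl).

Definition ratfun (k0 : fieldType) (F : fext k0) : fext k0 :=
  @Fext k0 {fraction {poly F}}
    ((@tofrac {poly F} \o @polyC F) \o fstr F).

Definition ratfun_hom (k0 : fieldType) (F : fext k0) : fhom F (ratfun F) :=
  @FHom k0 F (ratfun F) (@tofrac {poly F} \o @polyC F) (fun=> erefl).

Definition ratfun_var (k0 : fieldType) (F : fext k0) : ratfun F :=
  @tofrac {poly F} 'X.

Definition finite_ext (k0 : fieldType) (F E : fext k0) (f : fhom F E) : Prop :=
  exists (n : nat) (e : 'I_n -> E),
    forall x : E, exists c : 'I_n -> F, x = \sum_(i < n) f (c i) * e i.

(* K^M_*(F) is the ring presented by generators {a}, a in F^*, subject to     *)
(* {ab} = {a} + {b} and {a}{1-a} = 0, i.e. the tensor ring of the Z-module    *)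
(* F^* modulo the Steinberg relations: terms modulo the least ring congruence *)
(* containing these relations.  A generator {0} is also present for           *)
(* convenience, and is set to 0.                                              *)
Inductive kterm (F : Type) : Type :=
| KSym of F
| KZero
| KOne
| KOpp of kterm F
| KAdd of kterm F & kterm F
| KMul of kterm F & kterm F.
Arguments KZero {F}.
Arguments KOne {F}.

Inductive kequiv (F : fieldType) : kterm F -> kterm F -> Prop :=
| kequiv_refl s : kequiv s s
| kequiv_sym s t : kequiv s t -> kequiv t s
| kequiv_trans s t u : kequiv s t -> kequiv t u -> kequiv s u
| kequiv_opp s s' : kequiv s s' -> kequiv (KOpp s) (KOpp s')
| kequiv_add s s' t t' :
    kequiv s s' -> kequiv t t' -> kequiv (KAdd s t) (KAdd s' t')
| kequiv_mul s s' t t' :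
    kequiv s s' -> kequiv t t' -> kequiv (KMul s t) (KMul s' t')
| kequiv_addA s t u : kequiv (KAdd s (KAdd t u)) (KAdd (KAdd s t) u)
| kequiv_addC s t : kequiv (KAdd s t) (KAdd t s)
| kequiv_add0 s : kequiv (KAdd KZero s) s
| kequiv_addN s : kequiv (KAdd (KOpp s) s) KZero
| kequiv_mulA s t u : kequiv (KMul s (KMul t u)) (KMul (KMul s t) u)
| kequiv_mul1l s : kequiv (KMul KOne s) s
| kequiv_mul1r s : kequiv (KMul s KOne) s
| kequiv_mulDl s t u :
    kequiv (KMul (KAdd s t) u) (KAdd (KMul s u) (KMul t u))
| kequiv_mulDr s t u :
    kequiv (KMul s (KAdd t u)) (KAdd (KMul s t) (KMul s u))
| kequiv_sym0 : kequiv (KSym 0) KZero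
| kequiv_symM (a b : F) : a != 0 -> b != 0 ->
    kequiv (KSym (a * b)) (KAdd (KSym a) (KSym b))
| kequiv_steinberg (a : F) : a != 0 -> a != 1 ->
    kequiv (KMul (KSym a) (KSym (1 - a))) KZero.

Section MilnorK.
Variable F : fieldType.

HB.instance Definition _ := gen_eqMixin (kterm F).
HB.instance Definition _ := gen_choiceMixin (kterm F).

Definition krel : rel (kterm F) := fun s t => `[< kequiv s t >].

Lemma krel_refl : reflexive krel.
Proof. by move=> s; apply/asboolP; exact: kequiv_refl. Qed.

Lemma krel_sym : symmetric krel.
Proof. by move=> s t; apply/asboolP/asboolP; exact: kequiv_sym. Qed.

Lemma krel_trans : transitive krel.
Proof.
move=> t s u /asboolP st /asboolP tu; apply/asboolP; exact: kequiv_trans st tu.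
Qed.

Canonical krel_equiv := EquivRel krel krel_refl krel_sym krel_trans.

Definition KM : Type := {eq_quot krel}.
HB.instance Definition _ := Choice.on KM.
HB.instance Definition _ := EqQuotient.on KM.

Lemma kpi_eq (s t : kterm F) : kequiv s t -> \pi_KM s = \pi_KM t.
Proof. by move=> st; apply/eqmodP/asboolP. Qed.

Lemma krepr (s : kterm F) : kequiv (repr (\pi_KM s)) s.
Proof.
have /eqmodP/asboolP : \pi_KM (repr (\pi_KM s)) = \pi_KM s by rewrite reprK.
by [].
Qed.

Definition km_opp (x : KM) : KM := \pi_KM (KOpp (repr x)).
Definition km_add (x y : KM) : KM := \pi_KM (KAdd (repr x) (repr y)).
Definition km_mul (x y : KM) : KM := \pi_KM (KMul (repr x) (repr y)).

Lemma km_oppE s : km_opp (\pi_KM s) = \pi_KM (KOpp s).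
Proof. by apply/kpi_eq/kequiv_opp/krepr. Qed.

Lemma km_addE s t : km_add (\pi_KM s) (\pi_KM t) = \pi_KM (KAdd s t).
Proof. by apply/kpi_eq/kequiv_add; exact: krepr. Qed.

Lemma km_mulE s t : km_mul (\pi_KM s) (\pi_KM t) = \pi_KM (KMul s t).
Proof. by apply/kpi_eq/kequiv_mul; exact: krepr. Qed.

Lemma kpi_ind (P : KM -> Prop) : (forall s, P (\pi_KM s)) -> forall x, P x.
Proof. by move=> Ps x; rewrite -[x]reprK. Qed.

Lemma km_addA : associative km_add.
Proof.
elim/kpi_ind=> s; elim/kpi_ind=> t; elim/kpi_ind=> u.
by rewrite !km_addE; apply/kpi_eq/kequiv_addA.
Qed.

Lemma km_addC : commutative km_add.
Proof.
elim/kpi_ind=> s; elim/kpi_ind=> t.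
by rewrite !km_addE; apply/kpi_eq/kequiv_addC.
Qed.

Lemma km_add0 : left_id (\pi_KM KZero) km_add.
Proof. by elim/kpi_ind=> s; rewrite km_addE; apply/kpi_eq/kequiv_add0. Qed.

Lemma km_addN : left_inverse (\pi_KM KZero) km_opp km_add.
Proof.
by elim/kpi_ind=> s; rewrite km_oppE km_addE; apply/kpi_eq/kequiv_addN.
Qed.

HB.instance Definition _ :=
  GRing.isZmodule.Build KM km_addA km_addC km_add0 km_addN.

Lemma kpiD s t : \pi_KM s + \pi_KM t = \pi_KM (KAdd s t).
Proof. exact: km_addE. Qed.

Lemma kpiN s : - \pi_KM s = \pi_KM (KOpp s).
Proof. exact: km_oppE. Qed.

Lemma km_mulA : associative km_mul.
Proof.
elim/kpi_ind=> s; elim/kpi_ind=> t; elim/kpi_ind=> u.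
by rewrite !km_mulE; apply/kpi_eq/kequiv_mulA.
Qed.

Lemma km_mul1l : left_id (\pi_KM KOne) km_mul.
Proof. by elim/kpi_ind=> s; rewrite km_mulE; apply/kpi_eq/kequiv_mul1l. Qed.

Lemma km_mul1r : right_id (\pi_KM KOne) km_mul.
Proof. by elim/kpi_ind=> s; rewrite km_mulE; apply/kpi_eq/kequiv_mul1r. Qed.

Lemma km_mulDl : left_distributive km_mul +%R.
Proof.
elim/kpi_ind=> s; elim/kpi_ind=> t; elim/kpi_ind=> u.
by rewrite !(kpiD, km_mulE); apply/kpi_eq/kequiv_mulDl.
Qed.

Lemma km_mulDr : right_distributive km_mul +%R.
Proof.
elim/kpi_ind=> s; elim/kpi_ind=> t; elim/kpi_ind=> u.
by rewrite !(kpiD, km_mulE); apply/kpi_eq/kequiv_mulDr.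
Qed.

HB.instance Definition _ :=
  GRing.Zmodule_isPzRing.Build KM km_mulA km_mul1l km_mul1r km_mulDl km_mulDr.

Lemma kpiM s t : \pi_KM s * \pi_KM t = \pi_KM (KMul s t).
Proof. exact: km_mulE. Qed.

Definition ksym (a : F) : KM := \pi_KM (KSym a).

(* Degree n part: integral combinations of the symbols {a_1}...{a_n}.         *)
Definition kdeg (n : nat) : set KM :=
  [set x | exists (r : nat) (c : 'I_r -> int) (a : 'I_r -> n.-tuple F),
     x = \sum_(j < r) (\prod_(b <- a j) ksym b) *~ c j].

Lemma kdeg_zmod n : zmod_closed (fun x => `[< kdeg n x >]).
Proof.
split=> [|x y /asboolP[r [c [a ->]]] /asboolP[s [d [b ->]]]]; apply/asboolP.
  by exists 0%N, (fun=> 0), (fun=> nseq_tuple n 0); rewrite big_ord0.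
pose cd (i : 'I_(r + s)) := match split i with inl j => c j | inr j => - d j end.
pose ab (i : 'I_(r + s)) := match split i with inl j => a j | inr j => b j end.
exists (r + s)%N, cd, ab; rewrite big_split_ord /= -sumrN; congr (_ + _).
  apply: eq_bigr => j _; rewrite /cd /ab.
  by rewrite (unsplitK (inl j : 'I_r + 'I_s)).
apply: eq_bigr => j _; rewrite /cd /ab.
by rewrite (unsplitK (inr j : 'I_r + 'I_s)) mulrNz.
Qed.

Definition kdeg_pred (n : nat) : pred KM := fun x => `[< kdeg n x >].
HB.instance Definition _ n :=
  GRing.isZmodClosed.Build KM (kdeg_pred n) (kdeg_zmod n).

Record KMi (n : nat) := InKMi { kmi_val :> KM; _ : kdeg_pred n kmi_val }.
HB.instance Definition _ n := [isSub for @kmi_val n].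
HB.instance Definition _ n := [Choice of KMi n by <:].
HB.instance Definition _ n := [SubChoice_isSubZmodule of KMi n by <:].

End MilnorK.

Section MilnorKFunctor.
Variables (F E : fieldType) (f : {rmorphism F -> E}).

Fixpoint kterm_map (s : kterm F) : kterm E :=
  match s with
  | KSym a => KSym (f a)
  | KZero => KZero
  | KOne => KOne
  | KOpp s => KOpp (kterm_map s)
  | KAdd s t => KAdd (kterm_map s) (kterm_map t)
  | KMul s t => KMul (kterm_map s) (kterm_map t)
  end.

Lemma kterm_map_equiv s t : kequiv s t -> kequiv (kterm_map s) (kterm_map t).
Proof.
elim=> /=.
- by move=> ?; exact: kequiv_refl.
- by move=> ? ? _; exact: kequiv_sym.
- by move=> ? ? ? _ h1 _ h2; exact: kequiv_trans h1 h2.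
- by move=> ? ? _; exact: kequiv_opp.
- by move=> ? ? ? ? _ h1 _ h2; exact: kequiv_add.
- by move=> ? ? ? ? _ h1 _ h2; exact: kequiv_mul.
- by move=> *; exact: kequiv_addA.
- by move=> *; exact: kequiv_addC.
- by move=> *; exact: kequiv_add0.
- by move=> *; exact: kequiv_addN.
- by move=> *; exact: kequiv_mulA.
- by move=> *; exact: kequiv_mul1l.
- by move=> *; exact: kequiv_mul1r.
- by move=> *; exact: kequiv_mulDl.
- by move=> *; exact: kequiv_mulDr.
- by rewrite rmorph0; exact: kequiv_sym0.
- by move=> a b a0 b0; rewrite rmorphM; apply: kequiv_symM; rewrite fmorph_eq0.
- move=> a a0 a1; rewrite rmorphB rmorph1.
  by apply: kequiv_steinberg; rewrite ?fmorph_eq0 ?fmorph_eq1.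
Qed.

Definition KM_map (x : KM F) : KM E := \pi_(KM E) (kterm_map (repr x)).

Lemma KM_mapE s : KM_map (\pi_(KM F) s) = \pi_(KM E) (kterm_map s).
Proof. by apply/kpi_eq/kterm_map_equiv/krepr. Qed.

Lemma KM_map_sym a : KM_map (ksym a) = ksym (f a).
Proof. exact: KM_mapE. Qed.

Lemma KM_map_zmod : zmod_morphism KM_map.
Proof.
move=> x y; elim/kpi_ind: x => s; elim/kpi_ind: y => t.
by rewrite (kpiN t) (kpiD s) !KM_mapE kpiN kpiD.
Qed.
HB.instance Definition _ :=
  GRing.isZmodMorphism.Build (KM F) (KM E) KM_map KM_map_zmod.

Lemma KM_map_monoid : monoid_morphism KM_map.
Proof.
split; first exact: KM_mapE.
move=> x y; elim/kpi_ind: x => s; elim/kpi_ind: y => t.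
by rewrite (kpiM s) !KM_mapE kpiM.
Qed.
HB.instance Definition _ :=
  GRing.isMonoidMorphism.Build (KM F) (KM E) KM_map KM_map_monoid.

Lemma KM_map_deg n (x : KM F) : kdeg_pred n x -> kdeg_pred n (KM_map x).
Proof.
move=> /asboolP[r [c [a ->]]]; apply/asboolP.
exists r, c, (fun j => map_tuple f (a j)).
rewrite raddf_sum; apply: eq_bigr => j _.
rewrite raddfMz big_map /=; congr (_ *~ _).
rewrite (big_morph KM_map KM_map_monoid.2 KM_map_monoid.1).
by apply: eq_bigr => b _; exact: KM_map_sym.
Qed.

Definition KMi_map n (x : KMi F n) : KMi E n :=
  InKMi (KM_map_deg (valP x)).

End MilnorKFunctor.

(* The subring j(k)[s] of R.                                                  *)
Inductive adjoin (k R : pzRingType) (j : k -> R) (s : seq R) : R -> Prop :=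
| adjoin_cst c : adjoin j s (j c)
| adjoin_gen a : a \in s -> adjoin j s a
| adjoin_add x y : adjoin j s x -> adjoin j s y -> adjoin j s (x + y)
| adjoin_mul x y : adjoin j s x -> adjoin j s y -> adjoin j s (x * y).

Definition ess_finite_type (k : fieldType) (A : comUnitRingType)
    (j : {rmorphism k -> A}) : Prop :=
  exists s : seq A, forall x : A,
    exists f g : A, [/\ adjoin j s f, adjoin j s g, g \is a GRing.unit
                      & x = f / g].

Definition is_ideal (A : comPzRingType) (I : set A) : Prop :=
  [/\ I 0, (forall x y, I x -> I y -> I (x + y))
    & (forall a x, I x -> I (a * x))].

Definition is_prime (A : comPzRingType) (p : set A) : Prop :=
  [/\ is_ideal p, ~ p 1 & forall x y, p (x * y) -> p x \/ p y].

Definition height_one (A : idomainType) (p : set A) : Prop :=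
  [/\ is_prime p, p <> [set 0]
    & forall q : set A, is_prime q -> q `<=` p -> q = [set 0] \/ q = p].

Definition prime_chain (A : comPzRingType) (d : nat) : Prop :=
  exists p : nat -> set A,
    (forall i, (i <= d)%N -> is_prime (p i)) /\
    (forall i, (i < d)%N -> p i `<` p i.+1).

Definition krull_dim (A : comPzRingType) (d : nat) : Prop :=
  prime_chain A d /\ ~ prime_chain A d.+1.

Definition is_local (A : unitRingType) : Prop :=
  forall x y : A, x \isn't a GRing.unit -> y \isn't a GRing.unit ->
    x + y \isn't a GRing.unit.

Definition ideal_chain (A : comPzRingType) (n : nat) : Prop :=
  exists I : nat -> set A,
    (forall i, (i <= n)%N -> is_ideal (I i)) /\
    (forall i, (i < n)%N -> I i `<` I i.+1).

Definition ring_length (A : comPzRingType) (n : nat) : Prop :=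
  ideal_chain A n /\ ~ ideal_chain A n.+1.

Definition is_localization (R S : comPzRingType) (p : set R)
    (f : {rmorphism R -> S}) : Prop :=
  [/\ (forall s, ~ p s -> exists u, u * f s = 1),
      (forall x, exists r s, ~ p s /\ x * f s = f r)
    & (forall r, f r = 0 -> exists s, ~ p s /\ s * r = 0)].

Definition local_length (R : comPzRingType) (p : set R) (n : nat) : Prop :=
  exists (S : comPzRingType) (f : {rmorphism R -> S}),
    is_localization p f /\ ring_length S n.

Definition mker (R S : pzRingType) (f : R -> S) : set R := [set a | f a = 0].

(* A point of Spec A, given as the map from A to its residue field.           *)
Definition is_point (A : pzRingType) (K : fieldType) (x : A -> K) : Prop :=
  forall c : K, exists a b : A, x b != 0 /\ c = x a / x b.

Definition is_normal (A : idomainType) (F : fieldType)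
    (i : {rmorphism A -> F}) : Prop :=
  forall x : F, (exists p : {poly A}, p \is monic /\ (map_poly i p).[x] = 0) ->
    exists a : A, x = i a.

(* R, with its two maps, is the tensor product of L and E over F, as the      *)
(* pushout of f and g in commutative rings.                                   *)
Definition is_tensor (F L E : fieldType) (g : F -> L) (f : F -> E)
    (R : comPzRingType) (a : {rmorphism L -> R}) (b : {rmorphism E -> R}) :=
  (forall x, a (g x) = b (f x)) /\
  forall (S : comPzRingType) (a' : {rmorphism L -> S}) (b' : {rmorphism E -> S}),
    (forall x, a' (g x) = b' (f x)) ->
    exists h : {rmorphism R -> S},
      [/\ h \o a =1 a', h \o b =1 b'
        & forall h' : {rmorphism R -> S},
            h' \o a =1 a' -> h' \o b =1 b' -> h' =1 h].

(* As in Rost, valuations are normalized, trivial on k0, and of geometric     *)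
(* type: the valuation ring is the localization, at a prime, of a domain of   *)
(* finite type over a field.  The record carries a model of the residue field *)
(* together with the reduction map (meaningful on the valuation ring only).   *)
(* By convention val 0 = 0.                                                   *)
Record dval (k0 : fieldType) (F : fext k0) := DVal {
  val : F -> int;
  resf : fext k0;
  red : F -> resf;
  val0 : val 0 = 0;
  valM : forall x y, x != 0 -> y != 0 -> val (x * y) = val x + val y;
  valD : forall x y, x != 0 -> y != 0 -> x + y != 0 ->
    Num.min (val x) (val y) <= val (x + y);
  val_prime : exists p, val p = 1;
  val_str : forall a : k0, val (fstr F a) = 0;
  redD : forall x y, 0 <= val x -> 0 <= val y -> red (x + y) = red x + red y;
  redM : forall x y, 0 <= val x -> 0 <= val y -> red (x * y) = red x * red y;
  red_surj : forall c, exists2 x, 0 <= val x & red x = c;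
  red_eq0 : forall x, 0 <= val x -> red x = 0 <-> x = 0 \/ 0 < val x;
  red_str : forall a : k0, red (fstr F a) = fstr resf a;
  val_geom : exists (k : fext k0) (j : fhom k F) (s : seq F),
    [/\ (forall c, val (j c) = 0),
        (forall a, a \in s -> 0 <= val a)
      & (forall x, 0 <= val x -> exists f g,
           [/\ adjoin j s f, adjoin j s g, g != 0, val g = 0 & x = f / g])]
}.

Section Valuations.
Variable k0 : fieldType.
Implicit Types F E : fext k0.

Definition vring F (v : dval F) : set F := [set x | 0 <= val v x].

Definition same_val F (v w : dval F) : Prop := val v =1 val w.

Definition trivial_on F E (f : fhom F E) (v : dval E) : Prop :=
  forall x, val v (f x) = 0.

Definition lies_over F E (f : fhom F E) (w : dval E) (v : dval F) (e : nat) :=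
  (0 < e)%N /\ forall x, val w (f x) = val v x * e%:Z.

Definition induced_res F E (f : fhom F E) (w : dval E) (v : dval F)
    (fbar : fhom (resf v) (resf w)) : Prop :=
  forall x, vring v x -> fbar (red v x) = red w (f x).

(* The residue map (tame symbol) is the additive map determined by:           *)
(*   {u_1}...{u_n} |-> 0,  {pi}{u_1}...{u_n} |-> {red u_1}...{red u_n}.       *)
Definition is_milnor_residue F (v : dval F)
    (d : {additive KM F -> KM (resf v)}) : Prop :=
  forall us : seq F, (forall u, u \in us -> u != 0 /\ val v u = 0) ->
    d (\prod_(u <- us) ksym u) = 0 /\
    forall p, val v p = 1 ->
      d (ksym p * \prod_(u <- us) ksym u) = \prod_(u <- us) ksym (red v u).

(* Norm of the simple extension E = F[a], after Bass and Tate: if the class   *)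
(* al on F(t) has residue x at the place t |-> a and no residue at the other  *)
(* finite places, the norm of x is minus the residue of al at infinity.       *)
Definition simple_norm F E (f : fhom F E) (a : E) (x : KM E) (y : KM F) : Prop :=
  (forall c : E, exists p : {poly F}, c = (map_poly f p).[a]) /\
  exists al : KM (ratfun F),
    (forall (v : dval (ratfun F)) (d : {additive KM (ratfun F) -> KM (resf v)}),
       trivial_on (ratfun_hom F) v -> 0 <= val v (ratfun_var F) ->
       is_milnor_residue d ->
       let at_a (j : fhom (resf v) E) :=
         (forall c, j (red v (ratfun_hom F c)) = f c) /\
         j (red v (ratfun_var F)) = a in
       (forall j, at_a j -> KM_map j (d al) = x) /\
       ((forall j, ~ at_a j) -> d al = 0)) /\
    (forall (v : dval (ratfun F)) (d : {additive KM (ratfun F) -> KM (resf v)})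
            (j : fhom F (resf v)),
       trivial_on (ratfun_hom F) v -> val v (ratfun_var F) = - 1 ->
       (forall c, j c = red v (ratfun_hom F c)) ->
       is_milnor_residue d -> KM_map j y = - d al).

(* The graph of the norm map K^M_*(E) -> K^M_*(F) of a finite extension,      *)
(* obtained from simple extensions by composition; by a theorem of Kato it is *)
(* indeed the graph of a function.                                            *)
Inductive milnor_norm : forall F E, fhom F E -> KM E -> KM F -> Prop :=
| milnor_norm_simple F E (f : fhom F E) a x y :
    simple_norm f a x y -> milnor_norm f x y
| milnor_norm_comp F E L (f : fhom F E) (g : fhom E L) (h : fhom F L) x y z :
    (forall c, h c = g (f c)) ->
    milnor_norm g x y -> milnor_norm f y z -> milnor_norm h x z.

End Valuations.

(* M_*(F) is the total group, with an internal Z-grading.                     *)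
Definition is_grading (V : zmodType) (D : int -> set V) : Prop :=
  [/\ forall n, D n 0 /\ forall x y, D n x -> D n y -> D n (x - y),
      (forall x, exists (s : seq int) (c : int -> V),
         (forall n, D n (c n)) /\ x = \sum_(n <- s) c n)
    & (forall (s : seq int) (c : int -> V), uniq s ->
         (forall n, D n (c n)) -> \sum_(n <- s) c n = 0 ->
         forall n, n \in s -> c n = 0)].

(* cor is only meaningful (and only constrained) for finite extensions.       *)
Record cycle_data (k0 : fieldType) := CycleData {
  cmod :> forall F : fext k0, lmodType (KM F);
  cdeg : forall F, int -> set (cmod F);
  cres : forall F E (f : fhom F E), {additive cmod F -> cmod E};
  ccor : forall F E (f : fhom F E), {additive cmod E -> cmod F};
  cbd : forall F (v : dval F), {additive cmod F -> cmod (resf v)}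
}.
Arguments cdeg {k0} M F n : rename.
Arguments cres {k0} M {F E} f : rename.
Arguments ccor {k0} M {F E} f : rename.
Arguments cbd {k0} M {F} v : rename.

Definition cspec (k0 : fieldType) (M : cycle_data k0) (F : fext k0)
    (v : dval F) (p : F) (r : M F) : M (resf v) :=
  cbd M v (ksym (- p) *: r).

(* Degree conditions D1-D4 and rules R1a-R3e of Rost.                         *)
Section Premodule.
Variables (k0 : fieldType) (M : cycle_data k0).
Implicit Types F E L : fext k0.

Record is_cycle_premodule : Prop := {
  cp_grading : forall F, is_grading (cdeg M F);
  cp_res_deg : forall F E (f : fhom F E) n r,
    cdeg M F n r -> cdeg M E n (cres M f r);
  cp_cor_deg : forall F E (f : fhom F E) n r, finite_ext f ->
    cdeg M E n r -> cdeg M F n (ccor M f r);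
  cp_scale_deg : forall F (n : nat) (m : int) (x : KM F) (r : M F),
    kdeg n x -> cdeg M F m r -> cdeg M F (n%:Z + m) (x *: r);
  cp_bd_deg : forall F (v : dval F) n r,
    cdeg M F n r -> cdeg M (resf v) (n - 1) (cbd M v r);

  cp_R1a_id : forall F (f : fhom F F), f =1 id -> cres M f =1 id;
  cp_R1a : forall F E L (f : fhom F E) (g : fhom E L) (h : fhom F L),
    h =1 g \o f -> cres M h =1 cres M g \o cres M f;
  cp_R1b : forall F E L (f : fhom F E) (g : fhom E L) (h : fhom F L),
    finite_ext f -> finite_ext g ->
    h =1 g \o f -> ccor M h =1 ccor M f \o ccor M g;
  (* the K i are the residue fields of the points q i of Spec R, where        *)
  (* R is the tensor product of L and E over F                                *)
  cp_R1c : forall F E L (f : fhom F E) (g : fhom F L)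
      (R : comPzRingType) (a : {rmorphism L -> R}) (b : {rmorphism E -> R})
      (I : finType) (K : I -> fext k0) (q : forall i, {rmorphism R -> K i})
      (l : I -> nat)
      (fi : forall i, fhom L (K i)) (gi : forall i, fhom E (K i)),
    finite_ext f -> is_tensor g f a b ->
    (forall i, is_point (q i)) ->
    (forall p : set R, is_prime p -> exists! i, p = mker (q i)) ->
    (forall i, local_length (mker (q i)) (l i)) ->
    (forall i, fi i =1 q i \o a) -> (forall i, gi i =1 q i \o b) ->
    forall r : M E,
      cres M g (ccor M f r) =
      \sum_i ccor M (fi i) (cres M (gi i) r) *+ l i;

  cp_R2a : forall F E (f : fhom F E) (x : KM F) (r : M F),
    cres M f (x *: r) = KM_map f x *: cres M f r;
  cp_R2b : forall F E (f : fhom F E) (x : KM F) (m : M E), finite_ext f ->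
    ccor M f (KM_map f x *: m) = x *: ccor M f m;
  cp_R2c : forall F E (f : fhom F E) (y : KM E) (z : KM F) (r : M F),
    finite_ext f -> milnor_norm f y z ->
    ccor M f (y *: cres M f r) = z *: r;

  cp_R3a : forall F E (f : fhom F E) (w : dval E) (v : dval F) (e : nat)
      (fbar : fhom (resf v) (resf w)) (r : M F),
    lies_over f w v e -> induced_res f fbar ->
    cbd M w (cres M f r) = cres M fbar (cbd M v r) *+ e;
  cp_R3b : forall F E (f : fhom F E) (v : dval F)
      (I : finType) (w : I -> dval E) (fbar : forall i, fhom (resf v) (resf (w i))),
    finite_ext f ->
    (forall i, exists e, lies_over f (w i) v e) ->
    (forall (w' : dval E) e, lies_over f w' v e -> exists! i, same_val w' (w i)) ->
    (forall i, induced_res f (fbar i)) ->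
    forall r : M E,
      cbd M v (ccor M f r) = \sum_i ccor M (fbar i) (cbd M (w i) r);
  cp_R3c : forall F E (f : fhom F E) (v : dval E) (r : M F),
    trivial_on f v -> cbd M v (cres M f r) = 0;
  cp_R3d : forall F E (f : fhom F E) (v : dval E) (fbar : fhom F (resf v))
      (p : E) (r : M F),
    trivial_on f v -> (forall c, fbar c = red v (f c)) -> val v p = 1 ->
    cspec v p (cres M f r) = cres M fbar r;
  cp_R3e : forall F (v : dval F) (u : F) (r : M F),
    u != 0 -> val v u = 0 ->
    cbd M v (ksym u *: r) = - (ksym (red v u) *: cbd M v r)
}.

End Premodule.

Section CycleModule.
Variables (k0 : fieldType) (M : cycle_data k0).

(* Let x, y be points of Spec A.  The valuation w of kappa(x) has center y on *)
(* the closure of x.                                                          *)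
Definition centered (A : pzRingType) (Kx Ky : fext k0)
    (x : A -> Kx) (y : A -> Ky) (w : dval Kx) : Prop :=
  forall a, 0 <= val w (x a) /\ (y a = 0 <-> x a = 0 \/ 0 < val w (x a)).

(* Rost's map from M(kappa(x)) to M(kappa(y)), for y of codimension one in    *)
(* the closure Z of x: the sum of the corestrictions of the residues at the   *)
(* points over y of the normalization of Z.  The local rings at these points  *)
(* are the discrete valuation rings of kappa(x) dominating the local ring of  *)
(* Z at y.                                                                    *)
Definition point_residue (A : pzRingType) (Kx Ky : fext k0)
    (x : A -> Kx) (y : A -> Ky) (r : M Kx) (s : M Ky) : Prop :=
  exists (I : finType) (w : I -> dval Kx) (e : forall i, fhom Ky (resf (w i))),
    [/\ (forall i, centered x y (w i)),
        (forall w', centered x y w' -> exists! i, same_val w' (w i)),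
        (forall i a, e i (y a) = red (w i) (x a))
      & s = \sum_i ccor M (e i) (cbd M (w i) r)].

(* Finite support, for affine X = Spec A.                                     *)
Definition axiom_FD : Prop :=
  forall (k F : fext k0) (A : idomainType) (j : {rmorphism k -> A})
         (i : {rmorphism A -> F}),
    (forall c, i (j (fstr k c)) = fstr F c) ->
    ess_finite_type j -> injective i -> is_point i -> is_normal i ->
    forall r : M F,
      finite_set [set p : set A | height_one p /\
        exists v : dval F,
          [/\ (forall a, 0 <= val v (i a)),
              p = [set a | a = 0 \/ 0 < val v (i a)] & cbd M v r <> 0]].

(* Closedness, for X = Spec A.                                                *)
Definition axiom_C : Prop :=
  forall (k F K0 : fext k0) (A : idomainType) (j : {rmorphism k -> A})
         (xi : {rmorphism A -> F}) (x0 : {rmorphism A -> K0}),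
    (forall c, xi (j (fstr k c)) = fstr F c) ->
    (forall c, x0 (j (fstr k c)) = fstr K0 c) ->
    ess_finite_type j -> is_local A -> krull_dim A 2 ->
    injective xi -> is_point xi ->
    is_point x0 -> mker x0 = [set a | a \isn't a GRing.unit] ->
    forall (r : M F) (I : finType) (K : I -> fext k0)
           (x : forall i, {rmorphism A -> K i})
           (s : forall i, M (K i)) (t : I -> M K0),
      (forall i c, x i (j (fstr k c)) = fstr (K i) c) ->
      (forall i, is_point (x i) /\ height_one (mker (x i))) ->
      (forall i i', mker (x i) = mker (x i') -> i = i') ->
      (forall i, point_residue xi (x i) r (s i)) ->
      (forall i, point_residue (x i) x0 (s i) (t i)) ->
      (forall (K' : fext k0) (x' : {rmorphism A -> K'}) (s' : M K'),
         (forall c, x' (j (fstr k c)) = fstr K' c) ->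
         is_point x' -> height_one (mker x') ->
         (forall i, mker x' <> mker (x i)) ->
         point_residue xi x' r s' -> s' = 0) ->
      \sum_i t i = 0.

End CycleModule.

Record cycle_module (k0 : fieldType) := CycleModule {
  cm_data :> cycle_data k0;
  cm_premodule : is_cycle_premodule cm_data;
  cm_FD : axiom_FD cm_data;
  cm_C : axiom_C cm_data
}.

Definition sgnz (V : zmodType) (n : int) (x : V) : V :=
  if odd `|n|%N then - x else x.

(* Rules P1-P3 of Rost for a pairing M x M -> M which is associative,         *)
(* graded-commutative and unital.                                             *)
Section RingStructure.
Variables (k0 : fieldType) (M : cycle_module k0).
Implicit Types F E : fext k0.

Record ring_structure := RingStructure {
  cmul : forall F : fext k0, M F -> M F -> M F;
  cone : forall F : fext k0, M F;
  cmulDl : forall F, left_distributive (@cmul F) +%R;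
  cmulDr : forall F, right_distributive (@cmul F) +%R;
  cmul_deg : forall F n m (r s : M F),
    cdeg M F n r -> cdeg M F m s -> cdeg M F (n + m) (cmul r s);
  cmulA : forall F, associative (@cmul F);
  cmulC : forall F n m (r s : M F),
    cdeg M F n r -> cdeg M F m s -> cmul s r = sgnz (n * m) (cmul r s);
  cone_deg : forall F, cdeg M F 0 (cone F);
  cmul1l : forall F, left_id (cone F) (@cmul F);
  cmul1r : forall F, right_id (cone F) (@cmul F);
  cres_one : forall F E (f : fhom F E), cres M f (cone F) = cone E;
  cmul_P1a : forall F (x : KM F) (r s : M F), cmul (x *: r) s = x *: cmul r s;
  cmul_P1b : forall F (n : nat) (m : int) (x : KM F) (r s : M F),
    kdeg n x -> cdeg M F m r -> cmul r (x *: s) = sgnz (n%:Z * m) (x *: cmul r s);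
  cmul_P2a : forall F E (f : fhom F E) (r s : M F),
    cres M f (cmul r s) = cmul (cres M f r) (cres M f s);
  cmul_P2b : forall F E (f : fhom F E) (r : M F) (s : M E), finite_ext f ->
    ccor M f (cmul (cres M f r) s) = cmul r (ccor M f s);
  cmul_P2c : forall F E (f : fhom F E) (r : M E) (s : M F), finite_ext f ->
    ccor M f (cmul r (cres M f s)) = cmul (ccor M f r) s;
  cmul_P3 : forall F (v : dval F) (p : F) (n : int) (r s : M F),
    val v p = 1 -> cdeg M F n r ->
    cbd M v (cmul r s) =
      cmul (cbd M v r) (cspec v p s) + sgnz n (cmul (cspec v p r) (cbd M v s))
      + ksym (- 1) *: cmul (cbd M v r) (cbd M v s)
}.

End RingStructure.

(* Operations range over all field extensions of k0, so they live in a larger *)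
(* universe than the carriers of MathComp structures; hence the module of     *)
(* additive operations over M_*(k0) is not packaged as an lmodType: its       *)
(* operations are addop_plus, addop_scale, etc., with laws proved below.      *)

Section Operations.
Variables (k0 : fieldType) (M : cycle_module k0).

(* The ring M_*(k0).  The ring structure is a phantom argument, which         *)
(* determines the multiplication.                                             *)
Definition coef_ring (rM : ring_structure M) : Type := M (fbase k0).

Variable rM : ring_structure M.

HB.instance Definition _ := GRing.Zmodule.on (coef_ring rM).
HB.instance Definition _ :=
  GRing.Zmodule_isPzRing.Build (coef_ring rM)
    (@cmulA _ _ rM (fbase k0)) (@cmul1l _ _ rM (fbase k0))
    (@cmul1r _ _ rM (fbase k0)) (@cmulDl _ _ rM (fbase k0))
    (@cmulDr _ _ rM (fbase k0)).

Variable i : nat.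

Definition is_operation (phi : forall k : fext k0, KMi k i -> M k) : Prop :=
  forall (k k' : fext k0) (f : fhom k k') (x : KMi k i),
    phi k' (KMi_map f x) = cres M f (phi k x).

Record addop := AddOp {
  addop_fun :> forall k : fext k0, KMi k i -> M k;
  addop_nat : is_operation addop_fun;
  addop_add : forall (k : fext k0) (x y : KMi k i),
    addop_fun (x + y) = addop_fun x + addop_fun y
}.

Lemma addop_eq (phi psi : addop) :
  (forall (k : fext k0) (x : KMi k i), phi k x = psi k x) -> phi = psi.
Proof.
case: phi psi => [f fn fa] [g gn ga] /= fg.
have {}fg : f = g by apply: functional_extensionality_dep => k; apply/funext.
by case: _ / fg in gn ga *; congr AddOp; exact: Prop_irrelevance.
Qed.

Program Definition addop_zero := @AddOp (fun k x => 0) _ _.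
Next Obligation. by move=> k k' f x; rewrite raddf0. Qed.
Next Obligation. by rewrite addr0. Qed.

Program Definition addop_opp (phi : addop) :=
  @AddOp (fun k x => - phi k x) _ _.
Next Obligation. by move=> k k' f x; rewrite addop_nat raddfN. Qed.
Next Obligation. by rewrite addop_add opprD. Qed.

Program Definition addop_plus (phi psi : addop) :=
  @AddOp (fun k x => phi k x + psi k x) _ _.
Next Obligation. by move=> k k' f x; rewrite !addop_nat raddfD. Qed.
Next Obligation. by rewrite !addop_add addrACA. Qed.

Program Definition addop_scale (a : coef_ring rM) (phi : addop) :=
  @AddOp (fun k x => cmul rM (cres M (fbase_hom k) a) (phi k x)) _ _.
Next Obligation.
move=> k k' f x; rewrite addop_nat cmul_P2a; congr cmul.
apply: (cp_R1a (cm_premodule M)) => c /=.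
by rewrite fmap_str.
Qed.
Next Obligation. by rewrite addop_add cmulDr. Qed.

Lemma addop_plusA : associative addop_plus.
Proof. by move=> f g h; apply: addop_eq => k x /=; rewrite addrA. Qed.

Lemma addop_plusC : commutative addop_plus.
Proof. by move=> f g; apply: addop_eq => k x /=; rewrite addrC. Qed.

Lemma addop_plus0 : left_id addop_zero addop_plus.
Proof. by move=> f; apply: addop_eq => k x /=; rewrite add0r. Qed.

Lemma addop_plusN : left_inverse addop_zero addop_opp addop_plus.
Proof. by move=> f; apply: addop_eq => k x /=; rewrite addNr. Qed.

Lemma addop_scaleA (a b : coef_ring rM) phi :
  addop_scale a (addop_scale b phi) = addop_scale (a * b) phi.
Proof. by apply: addop_eq => k x /=; rewrite cmulA -cmul_P2a. Qed.

Lemma addop_scale1 : left_id (1 : coef_ring rM) addop_scale.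
Proof. by move=> f; apply: addop_eq => k x /=; rewrite cres_one cmul1l. Qed.

Lemma addop_scaleDr : right_distributive addop_scale addop_plus.
Proof. by move=> a f g; apply: addop_eq => k x /=; rewrite cmulDr. Qed.

Lemma addop_scaleDl (a b : coef_ring rM) phi :
  addop_scale (a + b) phi = addop_plus (addop_scale a phi) (addop_scale b phi).
Proof. by apply: addop_eq => k x /=; rewrite raddfD cmulDl. Qed.

Program Definition id_op : addop :=
  @AddOp (fun k (x : KMi k i) => (x : KM k) *: cone rM k) _ _.
Next Obligation.
by move=> k k' f x; rewrite (cp_R2a (cm_premodule M)) cres_one.
Qed.
Next Obligation. by rewrite scalerDl. Qed.

End Operations.

(* Main.v *)
From HB Require Import structures.
From mathcomp Require Import all_boot all_order all_algebra.
From mathcomp Require Import boolp classical_sets generic_quotient.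
Require Import Defs.

Set Implicit Arguments.
Unset Strict Implicit.
Unset Printing Implicit Defensive.

Import Order.TTheory GRing.Theory Num.Theory.
Local Open Scope classical_set_scope.
Local Open Scope ring_scope.
Local Open Scope quotient_scope.

(** An additive operation phi of degree i + 1 is lowered to degree i by
    evaluating it on the generic symbol: for y in K_i(k), let

      (lowering phi)(y) = d_0 (phi ({t} y)),

    where t is the variable of k(t) and d_0 : M(k(t)) -> M(k) is the residue
    at t = 0.  No information is lost, because

      phi ({u} y) = {u} (lowering phi)(y)      for all u in k^*.

    To see this, put r = phi ({t} y) and let sigma be the automorphism t |-> ut
    of k(t) over k.  Additivity of phi and {ut} = {u} + {t} give

      sigma r = r + phi ({u} y),

    the last term being constant, i.e. restricted from k.  Now specialize at
    t = 0, where specialization is s(x) = d_0({-t} x).  It is the identity on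
    constants, so the right-hand side becomes s(r) + phi ({u} y).  Since sigma
    preserves the valuation, induces the identity on the residue field and
    maps - t / u to - t, the left-hand side becomes d_0 ({- t / u} r), which
    is s(r) + {u} d_0(r).  Comparing the two is the formula (phi_symM).

    As K_(i+1) is generated by the products {u} y, induction on i shows that
    phi (x) = x b for some b in M(k0) (addop_scalar); the same lowering shows
    that b is unique (scalar_inj).  It remains to move b to the left of x.
    Graded commutativity changes the degree n component of b by the sign
    (-1)^(i n), which is a bijection of M(k0) onto itself. *)

(** * Fields of fractions *)

Lemma fraction_repr (R : idomainType) (x : {fraction R}) :
  x = tofrac (repr x).1 / tofrac (repr x).2.
Proof.
rewrite -[LHS]reprK; move: (repr x) => r; have d0 := denom_ratioP r.
have tofracE (p : R) : tofrac p = \pi_{fraction R} (Ratio p 1).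
  by unlock tofrac.
rewrite !tofracE /GRing.inv /= /GRing.mul /= !piE /FracField.invf.
by rewrite /FracField.mulf !numden_Ratio ?oner_neq0 // mulr1 mul1r
  FracField.Ratio_numden.
Qed.

Section FractionLift.
Variables (R : idomainType) (K : fieldType) (h : {rmorphism R -> K}).
Hypothesis h_inj : forall p, p != 0 -> h p != 0.

Definition fraction_lift (x : {fraction R}) : K :=
  h (repr x).1 / h (repr x).2.

Lemma fraction_liftE p q : q != 0 ->
  fraction_lift (tofrac p / tofrac q) = h p / h q.
Proof.
move=> q0; rewrite /fraction_lift; set r := repr _.
have d0 : r.2 != 0 := denom_ratioP r.
have /eqP := fraction_repr (tofrac p / tofrac q); rewrite -/r.
rewrite eqr_div ?tofrac_eq0 // -!tofracM tofrac_eq => /eqP pr.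
by apply/eqP; rewrite eqr_div ?h_inj // -!rmorphM pr.
Qed.

Lemma fraction_lift_tofrac p : fraction_lift (tofrac p) = h p.
Proof.
by rewrite -[tofrac p]divr1 -tofrac1 fraction_liftE ?oner_neq0 // rmorph1 divr1.
Qed.

Lemma fraction_lift_zmod : zmod_morphism fraction_lift.
Proof.
move=> x y; rewrite (fraction_repr x) (fraction_repr y).
have dx := denom_ratioP (repr x); have dy := denom_ratioP (repr y).
move: (repr x) (repr y) dx dy => a b a0 b0.
rewrite -mulNr -tofracN addf_div ?tofrac_eq0 // -!tofracM -tofracD.
rewrite !fraction_liftE ?mulf_neq0 // !(rmorphM, rmorphD, rmorphN).
by rewrite -[X in _ = _ + X]mulNr addf_div ?h_inj.
Qed.

Lemma fraction_lift_monoid : monoid_morphism fraction_lift.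
Proof.
split; first by rewrite -tofrac1 fraction_lift_tofrac rmorph1.
move=> x y; rewrite (fraction_repr x) (fraction_repr y).
have dx := denom_ratioP (repr x); have dy := denom_ratioP (repr y).
move: (repr x) (repr y) dx dy => a b a0 b0.
by rewrite mulf_div -!tofracM !fraction_liftE ?mulf_neq0 // !rmorphM mulf_div.
Qed.

HB.instance Definition _ :=
  GRing.isZmodMorphism.Build _ _ fraction_lift fraction_lift_zmod.
HB.instance Definition _ :=
  GRing.isMonoidMorphism.Build _ _ fraction_lift fraction_lift_monoid.

Definition fraction_lift_rmorphism : {rmorphism {fraction R} -> K} :=
  fraction_lift.

End FractionLift.

(** * The order of vanishing at the origin of a rational function *)

Section Jets.
Variable F : fieldType.
Local Notation Q := {fraction {poly F}}.
Local Notation T := (tofrac ('X : {poly F})).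
Implicit Types (n m : int) (c d : F) (x y : Q) (p q : {poly F}).

(** x has order at least n at the origin, and c, which may be zero, is the
    coefficient of X^n in its Laurent expansion.  Both the order and the
    value at the origin are read off this relation, and it is additive and
    multiplicative without any case distinction. *)
Definition jet n c x : Prop := exists p q,
  [/\ q.[0] != 0, x = T ^ n * (tofrac p / tofrac q) & c = p.[0] / q.[0]].

Lemma fracX_neq0 : T != 0.
Proof. by rewrite tofrac_eq0 polyX_eq0. Qed.

Lemma horner_neq0 p c : p.[c] != 0 -> p != 0.
Proof. by apply: contraNneq => ->; rewrite horner0. Qed.

Lemma jet_uniq n c d x : jet n c x -> jet n d x -> c = d.
Proof.
case=> [p [q [q0 -> ->]]] [p' [q' [q'0 e ->]]].
have /mulfI /(_ _ _ e) /eqP : T ^ n != 0 by rewrite expfz_neq0 // fracX_neq0.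
rewrite eqr_div ?tofrac_eq0 ?(horner_neq0 q0) ?(horner_neq0 q'0) //.
rewrite -!tofracM tofrac_eq => /eqP /(congr1 (fun r => r.[0])).
by rewrite !hornerM => e0; apply/eqP; rewrite eqr_div // e0.
Qed.

Lemma jetD n c d x y : jet n c x -> jet n d y -> jet n (c + d) (x + y).
Proof.
case=> [p [q [q0 -> ->]]] [p' [q' [q'0 -> ->]]].
exists (p * q' + p' * q), (q * q'); split.
- by rewrite hornerM mulf_neq0.
- by rewrite -mulrDr tofracD !tofracM addf_div // tofrac_eq0
    ?(horner_neq0 q0) ?(horner_neq0 q'0).
- by rewrite hornerD !hornerM addf_div.
Qed.

Lemma jetM n m c d x y : jet n c x -> jet m d y -> jet (n + m) (c * d) (x * y).
Proof.
case=> [p [q [q0 -> ->]]] [p' [q' [q'0 -> ->]]].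
exists (p * p'), (q * q'); split.
- by rewrite hornerM mulf_neq0.
- by rewrite mulrACA -expfzDr ?fracX_neq0 // !tofracM mulf_div.
- by rewrite !hornerM mulf_div.
Qed.

Lemma jet_lower n m c x : (m < n)%R -> jet n c x -> jet m 0 x.
Proof.
rewrite -subr_gt0; case e: (n - m) => [[|k]|] // _.
case=> [p [q [q0 -> _]]]; exists (p * 'X^(k.+1)), q; split=> //.
  rewrite -[n](subrK m) e addrC expfzDr ?fracX_neq0 // -mulrA; congr (_ * _).
  by rewrite -exprnP tofracM tofracXn mulrA; congr (_ / _); rewrite mulrC.
by rewrite hornerM hornerXn expr0n /= mulr0 mul0r.
Qed.

Lemma jet_raise n x : jet n 0 x -> exists c, jet (n + 1) c x.
Proof.
case=> [p [q [q0 -> /esym/eqP]]].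
rewrite mulf_eq0 invr_eq0 (negPf q0) orbF => p0.
have [r ->] : exists r, p = r * 'X.
  by have /factor_theorem[r ->] := p0; exists r; rewrite subr0.
exists (r.[0] / q.[0]), r, q; split=> //.
rewrite expfzDr ?fracX_neq0 // expr1z -!mulrA; congr (_ * _).
by rewrite tofracM mulrA; congr (_ / _); rewrite mulrC.
Qed.

Lemma jet_exists x : x != 0 -> exists n c, c != 0 /\ jet n c x.
Proof.
rewrite {1}[x]fraction_repr => x0.
have q0 := denom_ratioP (repr x); rewrite [x]fraction_repr.
move: (repr x) q0 x0 => r q0 x0.
have p0 : r.1 != 0 by apply: contraNneq x0 => ->; rewrite tofrac0 mul0r.
have [m [p pN0 pE]] := multiplicity_XsubC r.1 0.
have [l [q qN0 qE]] := multiplicity_XsubC r.2 0.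
rewrite p0 /= in pN0; rewrite q0 /= in qN0.
exists (m%:Z - l%:Z), (p.[0] / q.[0]); split.
  by rewrite mulf_neq0 ?invr_eq0.
exists p, q; split=> //; rewrite pE qE subr0 expfzDr ?fracX_neq0 //.
by rewrite !tofracM !tofracXn -exprnP -exprnN invfM mulrACA mulrC.
Qed.

Lemma jet_const c : jet 0 c (tofrac c%:P).
Proof.
exists c%:P, 1; split; rewrite ?hornerC ?oner_neq0 ?divr1 //.
by rewrite expr0z ?tofrac1 ?divr1 ?mul1r.
Qed.

Lemma jetX : jet 1 1 T.
Proof.
exists 1, 1; split; rewrite ?hornerC ?oner_neq0 ?divr1 //.
by rewrite expr1z ?tofrac1 ?divr1 ?mulr1.
Qed.

Lemma jet0 n : jet n 0 0.
Proof.
exists 0, 1; split; rewrite ?hornerC ?oner_neq0 ?mul0r //.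
by rewrite ?tofrac0 ?mul0r ?mulr0.
Qed.

(** The default value makes ord_X 0 = 0, since every jet of 0 vanishes. *)
Definition ord_X x : int := xget 0 [set n | exists2 c, c != 0 & jet n c x].
Definition lead_X x : F := xget 0 [set c | jet 0 c x].

Lemma jet_leading n c x : c != 0 -> jet n c x -> ord_X x = n.
Proof.
move=> c0 jx; apply: xget_unique => [|m [d d0 jd]]; first by exists c.
have [mn|nm|//] := ltgtP m n.
  by rewrite (jet_uniq (jet_lower mn jx) jd) eqxx in d0.
by rewrite (jet_uniq (jet_lower nm jd) jx) eqxx in c0.
Qed.

Lemma ord_X_jet x : x != 0 -> exists2 c, c != 0 & jet (ord_X x) c x.
Proof.
move=> /jet_exists[n [c [c0 jx]]].
by exists c => //; rewrite (jet_leading c0 jx).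
Qed.

Lemma jet_le_ord n c x : x != 0 -> jet n c x -> n <= ord_X x.
Proof.
move=> x0 jx; have [d d0 jd] := ord_X_jet x0.
rewrite leNgt; apply/negP => lt.
by rewrite (jet_uniq jd (jet_lower lt jx)) eqxx in d0.
Qed.

Lemma ord_X_ge n x : x != 0 -> n <= ord_X x -> exists c, jet n c x.
Proof.
move=> x0; have [c c0 jx] := ord_X_jet x0.
rewrite le_eqVlt => /predU1P[->|lt]; first by exists c.
by exists 0; exact: jet_lower lt jx.
Qed.

Lemma ord_X0 : ord_X 0 = 0.
Proof.
apply: xgetPN => n [c c0 jc].
by rewrite (jet_uniq jc (jet0 n)) eqxx in c0.
Qed.

Lemma ord_X_integral x : 0 <= ord_X x -> exists c, jet 0 c x.
Proof.
have [-> _|x0] := eqVneq x 0; first by exists 0; exact: jet0.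
exact: ord_X_ge.
Qed.

Lemma jet_ord_ge0 c x : jet 0 c x -> 0 <= ord_X x.
Proof.
by have [->|x0] := eqVneq x 0; rewrite ?ord_X0 //; exact: jet_le_ord.
Qed.

Lemma jet_lead_X c x : jet 0 c x -> lead_X x = c.
Proof.
by move=> jx; apply: xget_unique => // d jd; exact: jet_uniq jd jx.
Qed.

Lemma ord_X_const c : ord_X (tofrac c%:P) = 0.
Proof.
have [->|c0] := eqVneq c 0; first by rewrite polyC0 tofrac0 ord_X0.
exact: jet_leading c0 (jet_const c).
Qed.

Lemma lead_X_const c : lead_X (tofrac c%:P) = c.
Proof. exact/jet_lead_X/jet_const. Qed.

Lemma ord_XM x y : x != 0 -> y != 0 -> ord_X (x * y) = ord_X x + ord_X y.
Proof.
move=> /ord_X_jet[c c0 jx] /ord_X_jet[d d0 jy].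
by apply: jet_leading (jetM jx jy); rewrite mulf_neq0.
Qed.

Lemma ord_XD x y : x != 0 -> y != 0 -> x + y != 0 ->
  Num.min (ord_X x) (ord_X y) <= ord_X (x + y).
Proof.
move=> x0 y0 xy0; move n_def: (Num.min _ _) => n.
have nx : n <= ord_X x by rewrite -n_def ge_min lexx.
have ny : n <= ord_X y by rewrite -n_def ge_min lexx orbT.
have [[c jx] [d jy]] := (ord_X_ge x0 nx, ord_X_ge y0 ny).
exact: jet_le_ord xy0 (jetD jx jy).
Qed.

Lemma lead_XD x y : 0 <= ord_X x -> 0 <= ord_X y ->
  lead_X (x + y) = lead_X x + lead_X y.
Proof.
move=> /ord_X_integral[c jx] /ord_X_integral[d jy].
by rewrite (jet_lead_X jx) (jet_lead_X jy) (jet_lead_X (jetD jx jy)).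
Qed.

Lemma lead_XM x y : 0 <= ord_X x -> 0 <= ord_X y ->
  lead_X (x * y) = lead_X x * lead_X y.
Proof.
move=> /ord_X_integral[c jx] /ord_X_integral[d jy].
have jxy := jetM jx jy; rewrite addr0 in jxy.
by rewrite (jet_lead_X jx) (jet_lead_X jy) (jet_lead_X jxy).
Qed.

Lemma lead_X_eq0 x : 0 <= ord_X x -> lead_X x = 0 <-> x = 0 \/ 0 < ord_X x.
Proof.
move=> /ord_X_integral[c jx]; rewrite (jet_lead_X jx).
case: (eqVneq x 0) jx => [->|x0] jx.
  by split=> [_|_]; [left | exact: jet_uniq jx (jet0 0)].
split=> [c0|[/eqP|lt]]; last 2 first.
- by rewrite (negPf x0).
- by apply: contrapT => /eqP c0; rewrite (jet_leading c0 jx) in lt.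
rewrite c0 in jx; have [d jd] := jet_raise jx.
by right; rewrite (lt_le_trans _ (jet_le_ord x0 jd)).
Qed.

Lemma ord_XX : ord_X T = 1.
Proof. by apply: jet_leading jetX; exact: oner_neq0. Qed.

Lemma adjoin_const_X p :
  adjoin (@tofrac {poly F} \o @polyC F) [:: T] (tofrac p).
Proof.
elim/poly_ind: p => [|p c IHp].
  by rewrite -polyC0; exact: (adjoin_cst (@tofrac {poly F} \o @polyC F)).
rewrite tofracD tofracM; apply: adjoin_add.
  by apply: adjoin_mul => //; apply: adjoin_gen; rewrite inE.
exact: (adjoin_cst (@tofrac {poly F} \o @polyC F)).
Qed.

Lemma jet0_quo c x : jet 0 c x ->
  exists p q, q.[0] != 0 /\ x = tofrac p / tofrac q.
Proof.
by case=> [p [q [q0 -> _]]]; exists p, q; rewrite expr0z mul1r.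
Qed.

Lemma ord_X_poly p : p.[0] != 0 -> ord_X (tofrac p) = 0.
Proof.
move=> p0; apply: jet_leading p0 _; exists p, 1; split.
- by rewrite hornerC oner_neq0.
- by rewrite expr0z ?tofrac1 ?divr1 ?mul1r.
- by rewrite hornerC divr1.
Qed.

End Jets.

(** The valuation of F(X) at X = 0, with residue field F. *)
Section ValuationX.
Variables (k0 : fieldType) (F : fext k0).

(** The valuation ring is the localization of F[X] at the ideal (X). *)
Lemma ord_X_geom : exists (k : fext k0) (j : fhom k (ratfun F))
    (s : seq (ratfun F)),
  [/\ (forall c, ord_X (j c) = 0),
      (forall a, a \in s -> 0 <= ord_X a)
    & (forall x, 0 <= ord_X x -> exists f g,
         [/\ adjoin j s f, adjoin j s g, g != 0, ord_X g = 0 & x = f / g])].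
Proof.
exists F, (ratfun_hom F), [:: ratfun_var F]; split.
- by move=> c; exact: ord_X_const.
- by move=> a; rewrite inE => /eqP->; rewrite ord_XX.
move=> x /ord_X_integral[c /jet0_quo[p [q [q0 ->]]]].
exists (tofrac p), (tofrac q); split=> //.
- exact: adjoin_const_X.
- exact: adjoin_const_X.
- by rewrite tofrac_eq0 (horner_neq0 q0).
- exact: ord_X_poly.
Qed.

Definition dval_X : dval (ratfun F) :=
  @DVal k0 (ratfun F) (@ord_X F) F (@lead_X F) (@ord_X0 F) (@ord_XM F)
    (@ord_XD F) (ex_intro _ (ratfun_var F) (@ord_XX F))
    (fun a => @ord_X_const F (fstr F a)) (@lead_XD F) (@lead_XM F)
    (fun c => ex_intro2 _ _ (ratfun_hom F c)
       (jet_ord_ge0 (jet_const c)) (lead_X_const c))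
    (@lead_X_eq0 F) (fun a => @lead_X_const F (fstr F a)) ord_X_geom.

End ValuationX.

(** * The maps F(X) -> E(X) that send X to uX *)

(** With u = 1 these are the extensions of scalars that make the residue at
    X = 0 natural in the field; with E = F they are the automorphisms sigma
    that compare a symbol {u} with the generic one. *)
Section RatfunMaps.
Variables (k0 : fieldType) (F E : fext k0) (f : fhom F E) (u : E).
Hypothesis u_neq0 : u != 0.

Definition poly_scale_map : {rmorphism {poly F} -> {fraction {poly E}}} :=
  @tofrac {poly E} \o comp_poly (u *: 'X) \o map_poly f.

Lemma poly_scale_map_neq0 p : p != 0 -> poly_scale_map p != 0.
Proof.
move=> p0; rewrite /= tofrac_eq0 comp_poly2_eq0 ?map_poly_eq0 //.
by rewrite size_scale ?size_polyX.
Qed.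

Definition ratmap : fhom (ratfun F) (ratfun E).
Proof.
exists (fraction_lift_rmorphism poly_scale_map_neq0) => a.
rewrite /= fraction_lift_tofrac //=; last exact: poly_scale_map_neq0.
by rewrite map_polyC comp_polyC /= fmap_str.
Defined.

Lemma ratmap_const a : ratmap (ratfun_hom F a) = ratfun_hom E (f a).
Proof.
rewrite /= fraction_lift_tofrac //=; last exact: poly_scale_map_neq0.
by rewrite map_polyC comp_polyC.
Qed.

Lemma ratmap_var : ratmap (ratfun_var F) = ratfun_hom E u * ratfun_var E.
Proof.
rewrite /= fraction_lift_tofrac //=; last exact: poly_scale_map_neq0.
by rewrite map_polyX comp_polyX -mul_polyC tofracM.
Qed.

Lemma jet_ratmap n c x : jet n c x -> jet n (u ^ n * f c) (ratmap x).
Proof.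
case=> [p [q [q0 -> ->]]].
have ev r : (map_poly f r \Po (u *: 'X)).[0] = f r.[0].
  rewrite horner_comp hornerZ hornerX mulr0 -[0 in LHS](rmorph0 f).
  exact: horner_map.
exists (u ^ n *: (map_poly f p \Po (u *: 'X))), (map_poly f q \Po (u *: 'X)).
split.
- by rewrite ev fmorph_eq0.
- have uXn : ratmap (ratfun_var F ^ n) =
      ratfun_hom E (u ^ n) * ratfun_var E ^ n.
    by rewrite !fmorphXz ratmap_var exprzMl ?unitfE ?fmorph_eq0 ?fracX_neq0.
  rewrite rmorphM [X in X * _]uXn /= fraction_liftE ?(horner_neq0 q0) //;
    last exact: poly_scale_map_neq0.
  by rewrite -mul_polyC tofracM -mulrA mulrCA -mulrA.
- by rewrite hornerZ !ev fmorph_div mulrA.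
Qed.

Lemma ratmap_ord x : ord_X (ratmap x) = ord_X x.
Proof.
have [->|x0] := eqVneq x 0; first by rewrite rmorph0 !ord_X0.
have [c c0 jx] := ord_X_jet x0; apply: jet_leading (jet_ratmap jx).
by rewrite mulf_neq0 ?fmorph_eq0 ?expfz_neq0.
Qed.

(** The ramification index is 1 and the map of residue fields is f itself,
    whatever u is. *)
Lemma ratmap_lies_over : lies_over ratmap (dval_X E) (dval_X F) 1.
Proof. by split=> // x; rewrite mulr1; exact: ratmap_ord. Qed.

Lemma ratmap_induced_res :
  @induced_res k0 _ _ ratmap (dval_X E) (dval_X F) f.
Proof.
move=> x /ord_X_integral[c jx] /=; rewrite (jet_lead_X jx).
by rewrite (jet_lead_X (jet_ratmap jx)) expr0z mul1r.
Qed.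

End RatfunMaps.

(** * Symbols and the grading of Milnor K-theory *)

Section MilnorSymbols.
Variable F : fieldType.

Lemma ksym0 : ksym (0 : F) = 0.
Proof. exact/kpi_eq/kequiv_sym0. Qed.

Lemma ksymM (a b : F) : a != 0 -> b != 0 -> ksym (a * b) = ksym a + ksym b.
Proof. by move=> a0 b0; rewrite kpiD; apply/kpi_eq/kequiv_symM. Qed.

Lemma ksym1 : ksym (1 : F) = 0.
Proof.
apply: (addrI (ksym (1 : F))).
by rewrite -ksymM ?oner_neq0 // mulr1 addr0.
Qed.

Lemma ksymV (a : F) : a != 0 -> ksym a^-1 = - ksym a.
Proof.
move=> a0; apply: (addrI (ksym a)).
by rewrite -ksymM ?invr_eq0 // divff // ksym1 subrr.
Qed.

Lemma kdeg_prod n (a : n.-tuple F) : kdeg_pred n (\prod_(b <- a) ksym b).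
Proof.
apply/asboolP; exists 1%N, (fun=> 1), (fun=> a).
by rewrite big_ord1 mulr1z.
Qed.

Lemma kdeg_symM n (u : F) x : kdeg_pred n x -> kdeg_pred n.+1 (ksym u * x).
Proof.
move=> /asboolP[r [c [a ->]]]; apply/asboolP.
exists r, c, (fun j => [tuple of u :: a j]); rewrite mulr_sumr.
by apply: eq_bigr => j _; rewrite big_cons mulrzAr.
Qed.

Definition KMi_sym n (a : n.-tuple F) : KMi F n := InKMi (kdeg_prod a).

Definition symM n (u : F) (y : KMi F n) : KMi F n.+1 :=
  InKMi (kdeg_symM u (valP y)).

Lemma KMi_sym_cons n u (a : n.-tuple F) :
  KMi_sym [tuple of u :: a] = symM u (KMi_sym a).
Proof. by apply: val_inj; rewrite /= big_cons. Qed.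

Lemma symM0 n (y : KMi F n) : symM 0 y = 0.
Proof. by apply: val_inj; rewrite /= ksym0 mul0r. Qed.

Lemma symMD n u (y z : KMi F n) : symM u (y + z) = symM u y + symM u z.
Proof. by apply: val_inj; rewrite /= mulrDr. Qed.

Lemma KMi_ind n (P : KMi F n -> Prop) :
    P 0 -> (forall x y, P x -> P y -> P (x - y)) ->
    (forall a, P (KMi_sym a)) -> forall x, P x.
Proof.
move=> P0 PB Psym x.
have PN y : P y -> P (- y) by move=> Py; rewrite -[- y]add0r; exact: PB.
have PD y z : P y -> P z -> P (y + z).
  by move=> Py Pz; rewrite -[z]opprK; apply: PB (PN _ Pz).
have PMn y m : P y -> P (y *+ m).
  by move=> Py; elim: m => [|m IH]; rewrite ?mulr0n // mulrS; exact: PD.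
have /asboolP[r [c [a xE]]] := valP x.
have -> : x = \sum_(j < r) KMi_sym (a j) *~ c j.
  apply: val_inj; rewrite xE raddf_sum; apply: eq_bigr => j _.
  by rewrite raddfMz.
apply: big_ind => // j _; case: (c j) => m; first exact: PMn.
by rewrite NegzE mulrNz; apply/PN/PMn.
Qed.

End MilnorSymbols.

Lemma KM_map_comp (F E L : fieldType) (f : {rmorphism F -> E})
    (g : {rmorphism E -> L}) (h : {rmorphism F -> L}) :
  h =1 g \o f -> forall x, KM_map h x = KM_map g (KM_map f x).
Proof.
move=> hE; elim/kpi_ind=> s; rewrite !KM_mapE; congr (\pi _).
by elim: s => //= [a|s ->|s -> t ->|s -> t ->] //; rewrite hE.
Qed.

Lemma KMi_map_symM (F E : fieldType) (f : {rmorphism F -> E}) n (u : F)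
    (y : KMi F n) : KMi_map f (symM u y) = symM (f u) (KMi_map f y).
Proof. by apply: val_inj; rewrite /= rmorphM /= KM_map_sym. Qed.

Lemma KMi_map_comp (F E L : fieldType) (f : {rmorphism F -> E})
    (g : {rmorphism E -> L}) (h : {rmorphism F -> L}) n :
  h =1 g \o f -> forall x : KMi F n, KMi_map h x = KMi_map g (KMi_map f x).
Proof. by move=> hE x; apply: val_inj; exact: KM_map_comp. Qed.

Definition idhom (k0 : fieldType) (F : fext k0) : fhom F F :=
  @FHom k0 F F idfun (fun=> erefl).

Lemma dval_opp (k0 : fieldType) (F : fext k0) (v : dval F) x :
  val v (- x) = val v x.
Proof.
have [->|x0] := eqVneq x 0; first by rewrite oppr0.
rewrite -mulN1r valM ?oppr_eq0 ?oner_neq0 //.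
by rewrite -(rmorphN1 (fstr F)) val_str add0r.
Qed.

(** * The residue at the origin in a cycle module *)

Section Residue.
Variables (k0 : fieldType) (M : cycle_module k0).
Let MP := cm_premodule M.

Lemma cres_id (F : fext k0) (f : fhom F F) r : f =1 id -> cres M f r = r.
Proof. by move=> f1; exact: cp_R1a_id MP _ _ f1 r. Qed.

(** The residue of {p} z for a constant z is the specialization of z with
    respect to the uniformizer - p, and specialization undoes restriction. *)
Lemma residue_uniformizer (k : fext k0) (p : ratfun k) (z : M k) :
  ord_X p = 1 ->
  cbd M (dval_X k) (ksym p *: cres M (ratfun_hom k) z) = z.
Proof.
move=> p1; rewrite -[p]opprK.
have := @cp_R3d _ _ MP k (ratfun k) (ratfun_hom k) (dval_X k) (idhom k)
  (- p) z.
rewrite /cspec [cres M (idhom k) z]cres_id //; apply.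
- by move=> a; exact: ord_X_const.
- by move=> a /=; rewrite lead_X_const.
- by rewrite dval_opp.
Qed.

Lemma residue_ratmap (k k' : fext k0) (f : fhom k k') (u : k') (u0 : u != 0)
    (r : M (ratfun k)) :
  cbd M (dval_X k') (cres M (ratmap f u0) r) = cres M f (cbd M (dval_X k) r).
Proof.
exact: (cp_R3a MP r (ratmap_lies_over f u0) (ratmap_induced_res f u0)).
Qed.

End Residue.

(** * Lowering the degree of an operation *)

Section Lowering.
Variables (k0 : fieldType) (M : cycle_module k0).
Let MP := cm_premodule M.
Variables (i : nat) (phi : addop M i.+1).

Definition generic_value (k : fext k0) (y : KMi k i) : M (ratfun k) :=
  phi (ratfun k) (symM (ratfun_var k) (KMi_map (ratfun_hom k) y)).

Definition lowering_fun (k : fext k0) (y : KMi k i) : M k :=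
  cbd M (dval_X k) (generic_value y).

Lemma lowering_nat : is_operation lowering_fun.
Proof.
move=> k k' f y; rewrite /lowering_fun -(residue_ratmap _ (oner_neq0 k')).
congr (cbd M (dval_X k') _); rewrite -addop_nat KMi_map_symM ratmap_var.
rewrite rmorph1 mul1r /generic_value; congr (phi _ (symM _ _)).
rewrite -(@KMi_map_comp _ _ _ _ _ (ratfun_hom k' \o f)) //.
by apply: KMi_map_comp => a; exact: esym (ratmap_const f (oner_neq0 k') a).
Qed.

Lemma lowering_add (k : fext k0) (x y : KMi k i) :
  lowering_fun (x + y) = lowering_fun x + lowering_fun y.
Proof.
rewrite /lowering_fun /generic_value -raddfD -addop_add -symMD.
suff -> : KMi_map (ratfun_hom k) (x + y) =
  KMi_map (ratfun_hom k) x + KMi_map (ratfun_hom k) y by [].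
by apply: val_inj; rewrite /= raddfD.
Qed.

Definition lowering : addop M i := AddOp lowering_nat lowering_add.

(** The symbol {u} is the difference of {ut} and {t}, that is, of two values of
    phi which are conjugate under sigma and can be compared at t = 0. *)
Lemma phi_symM (k : fext k0) (u : k) (y : KMi k i) : u != 0 ->
  phi k (symM u y) = ksym u *: lowering k y.
Proof.
move=> u0; set z := phi k _; pose sigma := ratmap (idhom k) u0.
pose c := ratfun_hom k; pose t := ratfun_var k; pose r := generic_value y.
have t0 : t != 0 by exact: fracX_neq0.
have cu0 : c u != 0 by rewrite fmorph_eq0.
have cv0 : c u^-1 != 0 by rewrite fmorph_eq0 invr_eq0.
have nt0 : - t != 0 by rewrite oppr_eq0 t0.
(* sigma maps {t} y to {ut} y = {t} y + {u} y. *)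
have sr : cres M sigma r = r + cres M c z.
  rewrite -!addop_nat -addop_add; congr (phi _ _); apply: val_inj.
  rewrite /= rmorphM /= KM_map_sym [KM_map c (_ * _)]rmorphM /= KM_map_sym.
  rewrite -(@KM_map_comp _ _ _ _ _ c); last first.
    by move=> a; exact: esym (ratmap_const (idhom k) u0 a).
  have -> : sigma (ratfun_var k) = c u * t by exact: ratmap_var.
  by rewrite (ksymM cu0 t0) mulrDl; exact: addrC.
(* w is the preimage of - t under sigma. *)
pose w : ratfun k := c u^-1 * - t.
have sw : sigma w = - t.
  rewrite rmorphM rmorphN [sigma (c _)]ratmap_const [sigma t]ratmap_var.
  by rewrite mulrN mulrA -rmorphM mulVf // rmorph1 mul1r.
have s1 : cbd M (dval_X k) (ksym (- t) *: cres M sigma r) =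
    cbd M (dval_X k) (ksym w *: r).
  rewrite -sw -KM_map_sym -(cp_R2a MP) residue_ratmap.
  exact: cres_id.
have s2 : cbd M (dval_X k) (ksym w *: r) =
    ksym u *: lowering k y + cbd M (dval_X k) (ksym (- t) *: r).
  rewrite (ksymM cv0 nt0) scalerDl raddfD; congr (_ + _).
  rewrite (cp_R3e MP _ cv0); last exact: ord_X_const.
  by rewrite [red _ _]lead_X_const (ksymV u0) scaleNr opprK.
move: s1; rewrite s2 sr scalerDr raddfD residue_uniformizer; last first.
  by rewrite -[RHS](@ord_XX k); exact: (dval_opp (dval_X k)).
by rewrite addrC => /addIr ->.
Qed.

End Lowering.

(** * Additive operations are multiplication by a scalar on the right *)

Section Classification.
Variables (k0 : fieldType) (M : cycle_module k0).
Let MP := cm_premodule M.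

Lemma addop0 i (phi : addop M i) (k : fext k0) : phi k 0 = 0.
Proof. by apply: (addrI (phi k 0)); rewrite -addop_add !addr0. Qed.

Lemma addopB i (phi : addop M i) (k : fext k0) x y :
  phi k (x - y) = phi k x - phi k y.
Proof. by apply: (addIr (phi k y)); rewrite -addop_add !subrK. Qed.

Definition KMi_one (k : fext k0) : KMi k 0 := KMi_sym [tuple].

Lemma KMi_sym_nil (k : fext k0) (a : 0.-tuple k) : (KMi_sym a : KM k) = 1.
Proof. by rewrite /= tuple0 big_nil. Qed.

Lemma addop_scalar i (phi : addop M i) :
  exists b : M (fbase k0), forall (k : fext k0) (x : KMi k i),
    phi k x = (x : KM k) *: cres M (fbase_hom k) b.
Proof.
elim: i phi => [|i IHi] phi.
  exists (phi (fbase k0) (KMi_one (fbase k0))) => k.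
  elim/KMi_ind=> [|x y IHx IHy|a]; first by rewrite addop0 scale0r.
    by rewrite addopB IHx IHy -scalerBl.
  rewrite -addop_nat KMi_sym_nil scale1r; congr (phi k _); apply: val_inj.
  by apply: etrans (KMi_sym_nil a) _; rewrite /= big_nil rmorph1.
have [b bE] := IHi (lowering phi); exists b => k.
elim/KMi_ind=> [|x y IHx IHy|a]; first by rewrite addop0 scale0r.
  by rewrite addopB IHx IHy -scalerBl.
case/tupleP: a => u a; rewrite KMi_sym_cons.
have [->|u0] := eqVneq u 0; first by rewrite symM0 addop0 scale0r.
by rewrite phi_symM // bE scalerA.
Qed.

(** As x b is the residue at t = 0 of ({t} x) b, the hypothesis descends from
    degree i to degree i - 1, and finally to degree 0, where x can be 1. *)
Lemma scalar_inj i (b : M (fbase k0)) :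
  (forall (k : fext k0) (x : KMi k i),
     (x : KM k) *: cres M (fbase_hom k) b = 0) -> b = 0.
Proof.
elim: i => [|i IHi] b0.
  have := b0 (fbase k0) (KMi_one (fbase k0)); rewrite KMi_sym_nil scale1r.
  by rewrite cres_id.
apply: IHi => k x; set z := _ *: _.
rewrite -(residue_uniformizer z (@ord_XX k)).
rewrite (cp_R2a MP).
rewrite -[cres M _ (cres M _ _)](cp_R1a MP (h := fbase_hom (ratfun k))) //.
rewrite scalerA (b0 _ (symM (ratfun_var k) (KMi_map (ratfun_hom k) x))).
by rewrite raddf0.
Qed.

End Classification.

(** * Moving the scalar to the left *)

Section Signs.
Variables (k0 : fieldType) (M : cycle_module k0) (rM : ring_structure M).
Let MP := cm_premodule M.

Lemma sgnz_eq0 (V : zmodType) n (x : V) : (sgnz n x == 0) = (x == 0).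
Proof. by rewrite /sgnz; case: ifP; rewrite ?oppr_eq0. Qed.

Lemma sgnzK (V : zmodType) n : involutive (@sgnz V n).
Proof. by move=> x; rewrite /sgnz; case: odd; rewrite ?opprK. Qed.

Lemma raddf_sgnz (U V : zmodType) (f : {additive U -> V}) n x :
  f (sgnz n x) = sgnz n (f x).
Proof. by rewrite /sgnz; case: ifP; rewrite ?raddfN. Qed.

Lemma cdeg_opp F n (x : M F) : cdeg M F n x -> cdeg M F n (- x).
Proof.
have [D _ _] := cp_grading MP F; have [D0 DB] := D n.
by move=> Dx; rewrite -sub0r; exact: DB.
Qed.

Lemma cdeg_sgnz F n m (x : M F) : cdeg M F n x -> cdeg M F n (sgnz m x).
Proof. by rewrite /sgnz; case: ifP => // _; exact: cdeg_opp. Qed.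

Lemma cdeg_mulrn F n m (x : M F) : cdeg M F n x -> cdeg M F n (x *+ m).
Proof.
have [D _ _] := cp_grading MP F; have [D0 DB] := D n.
move=> Dx; elim: m => [|m IH]; first by rewrite mulr0n.
by rewrite mulrSr -[X in _ + X]opprK; exact: DB IH (cdeg_opp Dx).
Qed.

(** The degrees in the decomposition provided by the grading may be repeated;
    repetitions are absorbed into multiplicities, so that the components
    become unique. *)
Lemma homogeneous_decomposition F (x : M F) :
  exists (s : seq int) (c : int -> M F),
  [/\ uniq s, forall n, cdeg M F n (c n) & x = \sum_(n <- s) c n].
Proof.
have [_ gen _] := cp_grading MP F; have [s [c [cD ->]]] := gen x.
exists (undup s), (fun n => c n *+ count_mem n s); split.
- exact: undup_uniq.
- by move=> n; exact: cdeg_mulrn.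
- by rewrite -big_undup_iterop_count.
Qed.

(** Left multiplication of the identity operation by a scalar is right
    multiplication by the scalar twisted, in degree n, by (-1)^(i n). *)
Lemma cmul_id_op i (k : fext k0) (x : KMi k i) (s : seq int)
    (c : int -> M (fbase k0)) : (forall n, cdeg M (fbase k0) n (c n)) ->
  cmul rM (cres M (fbase_hom k) (\sum_(n <- s) c n)) ((x : KM k) *: cone rM k) =
  (x : KM k) *: cres M (fbase_hom k) (\sum_(n <- s) sgnz (i%:Z * n) (c n)).
Proof.
move=> cD; rewrite !raddf_sum.
set e := _ *: cone rM k.
have e0 : cmul rM 0 e = 0.
  by apply: (addrI (cmul rM 0 e)); rewrite -cmulDl !addr0.
rewrite (big_morph (fun r => cmul rM r e) (fun r s => cmulDl rM r s e) e0).
apply: eq_bigr => n _; rewrite /e raddf_sgnz.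
rewrite (cmul_P1b rM (n := i) (m := n)); last 2 first.
- by apply/asboolP; exact: (valP x).
- exact: (cp_res_deg MP).
by rewrite cmul1r raddf_sgnz.
Qed.

End Signs.

Theorem theorem5p6 (k0 : fieldType) (M : cycle_module k0)
    (rM : ring_structure M) (i : nat) :
  forall phi : addop M i,
    exists! a : coef_ring rM, phi = addop_scale a (id_op rM i).
Proof.
move=> phi; have [b bE] := addop_scalar phi.
have [s [c [_ cD bs]]] := homogeneous_decomposition b.
(* a is b with its components twisted back. *)
pose a : coef_ring rM := \sum_(n <- s) sgnz (i%:Z * n) (c n).
have phiE : phi = addop_scale a (id_op rM i).
  apply: addop_eq => k x; rewrite bE /= cmul_id_op => [|n];
    last exact: cdeg_sgnz.
  congr (_ *: cres M _ _); rewrite bs.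
  by apply: eq_bigr => n _; rewrite sgnzK.
(* The twisted components of a - a' sum to 0, so each of them is 0. *)
exists a; split=> // a' phiE'; apply/subr0_eq.
have [l [d [l_uniq dD dE]]] :=
  homogeneous_decomposition (a - a' : M (fbase k0)).
have [_ _ free] := cp_grading (cm_premodule M) (fbase k0).
have sum0 : \sum_(n <- l) sgnz (i%:Z * n) (d n) = 0.
  apply: (scalar_inj (i := i)) => k x; rewrite -(cmul_id_op rM) // -dE.
  rewrite raddfB; apply: (addIr (cmul rM (cres M (fbase_hom k) a')
    ((x : KM k) *: cone rM k))).
  rewrite -cmulDl subrK add0r.
  have /= := congr1 (fun psi : addop M i => psi k x) (etrans (esym phiE) phiE').
  exact.
apply: etrans dE _; rewrite big_seq big1 // => n ln; apply/eqP.
rewrite -(sgnz_eq0 (i%:Z * n)) (free _ _ l_uniq _ sum0) // => m.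
exact: cdeg_sgnz.
Qed.
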